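(* Let $d\ge1$ be an integer and let $S_d:=\{\mathbf{x}\in\mathbb{R}^d: x_i\ge 0 \text{ for all } i,\ x_1+\cdots+x_d\le 1\}$. Let $\mathbf{p}_1,\ldots,\mathbf{p}_n$ be independent random points, each uniformly distributed in $S_d$, and let $Z_n$ be the number of dominating records of $\mathbf{p}_1,\ldots,\mathbf{p}_n$. Then \[ \mathbb{E}[Z_n]=\sum_{1\le k\le n}\frac{(d!)^k\,\Gamma(k)^d}{\Gamma(dk+1)}, \] \[ \mathbb{V}[Z_n]=2\sum_{2\le k\le n}\frac{(d!)^k\,\Gamma(k)^d}{\Gamma(dk+1)}H_{k-1}^{(d)}+\sum_{1\le k\le n}\frac{(d!)^k\,\Gamma(k)^d}{\Gamma(dk+1)}-\left(\sum_{1\le k\le n}\frac{(d!)^k\,\Gamma(k)^d}{\Gamma(dk+1)}\right)^2, \] where $H_m^{(a)}=\sum_{i=1}^m i^{-a}$. Moreover, if instead $\mathbf{p}_1,\ldots,\mathbf{p}_n$ are independent and uniformly distributed in the hypercube $[0,1]^d$, then the number $Z_n$ of dominating records satisfies $\mathbb{E}[Z_n]=H_n^{(d)}$ and $\mathbb{V}[Z_n]=H_n^{(d)}-H_n^{(2d)}$.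
   Context: For $\mathbf{p},\mathbf{q}\in\mathbb{R}^d$, $\mathbf{p}$ dominates $\mathbf{q}$ (written $\mathbf{q}\prec\mathbf{p}$) if every coordinate of $\mathbf{p}-\mathbf{q}$ is strictly positive. A point $\mathbf{p}_k$ is a dominating record of the sequence $\mathbf{p}_1,\ldots,\mathbf{p}_n$ if $\mathbf{p}_i\prec\mathbf{p}_k$ for all $1\le i<k$ (so $\mathbf{p}_1$ is always a dominating record). *)

(* Defs.v *)
From HB Require Import structures.
From mathcomp Require Import all_boot all_order all_algebra.
From mathcomp Require Import all_classical all_reals all_analysis.
Set Implicit Arguments. Unset Strict Implicit. Unset Printing Implicit Defensive.
Import Order.TTheory GRing.Theory Num.Theory.
Local Open Scope ring_scope.
Local Open Scope classical_set_scope.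

Section Defs.
Variable R : realType.

Definition upd (v : nat -> R) (m : nat) (x : R) : nat -> R :=
  fun k => if k == m then x else v k.

(* Lebesgue integral over R^m (coordinates 0..m-1 of a vector nat -> R,
   coordinates >= m set to 0), computed as an iterated Lebesgue integral
   (Tonelli); only used for nonnegative integrands. *)
Fixpoint iint (m : nat) (f : (nat -> R) -> \bar R) : \bar R :=
  match m with
  | 0 => f (fun _ => 0)
  | m'.+1 => (\int[@lebesgue_measure R]_x iint m' (fun v => f (upd v m' x)))%E
  end.

Definition pt (d : nat) (x : nat -> R) (i : nat) : 'I_d -> R :=
  fun j => x (i * d + j)%N.

Definition simplex (d : nat) : set ('I_d -> R) :=
  [set y | (forall j, 0 <= y j) /\ \sum_(j < d) y j <= 1].
Definition cube (d : nat) : set ('I_d -> R) :=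
  [set y | forall j, 0 <= y j <= 1].

Definition vol (d : nat) (K : set ('I_d -> R)) : \bar R :=
  iint d (fun x => (\1_K (@pt d x 0))%:E).

(* expectation of g(p_0,...,p_{n-1}) for p_0..p_{n-1} i.i.d. uniform in K:
   integral of g against the product density prod_i 1_K(p_i)/vol(K) *)
Definition Eunif (d n : nat) (K : set ('I_d -> R))
  (g : (nat -> 'I_d -> R) -> R) : \bar R :=
  (iint (n * d) (fun x => (g (@pt d x) * \prod_(i < n) \1_K (@pt d x i))%:E)
   * ((fine (vol K)) ^- n)%:E)%E.

Definition Vunif (d n : nat) (K : set ('I_d -> R))
  (g : (nat -> 'I_d -> R) -> R) : \bar R :=
  Eunif n K (fun p => (g p - fine (Eunif n K g)) ^+ 2).

Definition dominated (d : nat) (q p : 'I_d -> R) : bool :=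
  [forall j : 'I_d, q j < p j].

Definition nrecords (d n : nat) (p : nat -> 'I_d -> R) : nat :=
  #|[set k : 'I_n | [forall i : 'I_n, (i < k)%N ==> dominated (p i) (p k)]]|.

Definition Zn (d n : nat) (p : nat -> 'I_d -> R) : R := (nrecords n p)%:R.

(* (d!)^k Gamma(k)^d / Gamma(dk+1), with Gamma(k) = (k-1)!, Gamma(dk+1) = (dk)! *)
Definition coefS (d k : nat) : R :=
  ((d`! ^ k * (k.-1)`! ^ d)%:R) / ((d * k)`!)%:R.

Definition harm (m a : nat) : R := \sum_(1 <= i < m.+1) (i%:R ^- a).

End Defs.

(* Main.v *)
Require Import Defs.
From HB Require Import structures.
From mathcomp Require Import all_boot all_order all_algebra.
From mathcomp Require Import all_classical all_reals all_analysis.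
From mathcomp Require Import measurable_realfun.
From mathcomp Require Import ring.
Import Order.TTheory GRing.Theory Num.Theory.
Import numFieldNormedType.Exports.
Local Open Scope ring_scope.

(* Write Z = sum_k I_k with I_k the indicator that p_k is a record.  The only
   geometric input is that the simplex and the cube are down-sets K of the
   nonnegative orthant: for y in K, the points of K dominated by y fill the box
   below y, so integrating out p_0, p_1, ... in turn, each point preceding the
   record p_j contributes a factor prod_c (p_j)_c.  With the moments
   M a = int_K prod_c y_c^a dy this gives, for 0-based j < k,
   P(I_k) = r k := M k / (M 0)^(k+1) and P(I_j I_k) = r k / (j+1)^d.
   The variance comes from integrating
   (Z - e)^2 + 2 e Z = Z^2 + e^2 with e the mean: all terms are nonnegative, so
   additivity of iterated integrals of nonnegative functions suffices. *)

(** * Iterated integrals *)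

Section IteratedIntegral.
Context {R : realType}.
Implicit Types (f g : (nat -> R) -> \bar R) (v : nat -> R).

(* [nat -> R] carries no sigma-algebra here, so measurability is tested along
   all measurable families of coordinates. *)
Definition coord_measurable f := forall d (T : measurableType d)
    (u : nat -> T -> R), (forall i, measurable_fun setT (u i)) ->
  measurable_fun setT (fun t => f (fun i => u i t)).

Lemma measurable_upd d (T : measurableType d) (u : nat -> T -> R) m
    (x : T -> R) : (forall i, measurable_fun setT (u i)) ->
  measurable_fun setT x ->
  forall i, measurable_fun setT (fun t => upd (fun i => u i t) m (x t) i).
Proof. by move=> mu mx i; rewrite /upd; case: (i == m). Qed.

Lemma iint_ge0 m f : (forall v, (0 <= f v)%E) -> (0 <= iint m f)%E.
Proof.
elim: m f => [|m IH] f f0 //=.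
by apply: integral_ge0 => x _; apply: IH.
Qed.

(** Induction on [m]: the outermost variable joins the parameters, so the parameter space becomes
    [T * R], and Tonelli's theorem gives measurability of the integral over that variable. Testing
    [h] along an arbitrary [T'] is what survives this change of space. *)
Lemma measurable_iint m d (T : measurableType d) (h : T -> (nat -> R) -> \bar R) :
  (forall t v, (0 <= h t v)%E) ->
  (forall d' (T' : measurableType d') (s : T' -> T) (u : nat -> T' -> R),
     measurable_fun setT s -> (forall i, measurable_fun setT (u i)) ->
     measurable_fun setT (fun t => h (s t) (fun i => u i t))) ->
  measurable_fun setT (fun t => iint m (h t)).
Proof.
elim: m d T h => [|m IH] d T h h0 mh /=.
  by apply: (mh _ T idfun (fun _ _ => 0)) => [|i]; [exact: measurable_id|exact: measurable_cst].
pose F (z : T * R) := iint m (fun v => h z.1 (upd v m z.2)).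
suff: measurable_fun setT (fubini_F lebesgue_measure F) by [].
apply: measurable_fun_fubini_tonelli_F; last first.
- by move=> z; apply: iint_ge0.
- rewrite /F; apply: IH => // d' T' s u ms mu.
  apply: (mh _ _ (fun t => (s t).1) (fun i t => upd (fun i => u i t) m (s t).2 i)).
    exact: measurableT_comp.
  by apply: measurable_upd => //; apply: measurableT_comp.
Qed.

Lemma coord_measurable_upd f m x :
  coord_measurable f -> coord_measurable (fun v => f (upd v m x)).
Proof.
move=> mf d T u mu.
apply: (mf _ _ (fun i t => upd (fun i => u i t) m x i)).
by apply: (measurable_upd _ _ _ _ (fun=> x)).
Qed.

Lemma measurable_iint_upd f m : coord_measurable f ->
  (forall v, (0 <= f v)%E) ->
  measurable_fun setT (fun x : R => iint m (fun v => f (upd v m x))).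
Proof.
move=> mf f0; apply: measurable_iint => // d T s u ms mu.
apply: (mf _ _ (fun i t => upd (fun i => u i t) m (s t) i)).
exact: measurable_upd.
Qed.

Lemma iintD m f g : coord_measurable f -> coord_measurable g ->
  (forall v, (0 <= f v)%E) -> (forall v, (0 <= g v)%E) ->
  iint m (fun v => f v + g v)%E = (iint m f + iint m g)%E.
Proof.
elim: m f g => [|m IH] f g mf mg f0 g0 //=.
rewrite -ge0_integralD//; last 4 first.
- by move=> x _; apply: iint_ge0.
- exact: measurable_iint_upd.
- by move=> x _; apply: iint_ge0.
- exact: measurable_iint_upd.
apply: eq_integral => x _.
by apply: IH => //; apply: coord_measurable_upd.
Qed.

(** Integration starts from the zero vector and [upd] only touches coordinates below [m]. *)
Lemma eq_iint m f g :
  (forall v, (forall i, (m <= i)%N -> v i = 0) -> f v = g v) ->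
  iint m f = iint m g.
Proof.
elim: m f g => [|m IH] f g fg /=; first exact: fg.
apply: eq_integral => x _; apply: IH => v v0; apply: fg => i mi.
by rewrite /upd gtn_eqF// v0// ltnW.
Qed.

Lemma iint_eq0 m f : (forall v, f v = 0%E) -> iint m f = 0%E.
Proof.
move=> f0; have -> : f = fun=> 0%E by apply/funext.
by elim: m {f0} => //= m ->; apply: integral0.
Qed.

Definition vcat a v w : nat -> R :=
  fun i => if (i < a)%N then v i else w (i - a)%N.

(** [iint] integrates the highest coordinate outermost, so the last [b] coordinates already form the
    outer block and no exchange of integrals is involved. *)
Lemma iint_addn a b f :
  iint (a + b) f = iint b (fun w => iint a (fun v => f (vcat a v w))).
Proof.
elim: b f => [|b IH] f /=.
  rewrite addn0; apply: eq_iint => v v0; congr f; apply/funext => i.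
  by rewrite /vcat; case: ltnP => // /v0.
rewrite addnS /=; apply: eq_integral => x _; rewrite IH.
congr iint; apply/funext => w; congr iint; apply/funext => v; congr f.
apply/funext => i; rewrite /upd /vcat; case: ltnP => [ia|ai].
  by rewrite ltn_eqF// ltn_addr.
by rewrite -{1}(subnKC ai) eqn_add2l.
Qed.

(** The constant [c] is general so that, at a fixed value of the outer variable, its factor [h d x]
    can be absorbed into [c] before the induction hypothesis applies. *)
Lemma iint_prod d (h : nat -> R -> R) (J : nat -> R) (c : R) : 0 <= c ->
  (forall i x, 0 <= h i x) -> (forall i, measurable_fun setT (h i)) ->
  (forall i, (i < d)%N -> (\int[lebesgue_measure]_x (h i x)%:E = (J i)%:E)%E) ->
  iint d (fun v => (c * \prod_(i < d) h i (v i))%:E)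
  = (c * \prod_(i < d) J i)%:E.
Proof.
move=> + h0 mh; elim: d c => [|d IH] c c0 hJ /=; first by rewrite !big_ord0.
transitivity (\int[@lebesgue_measure R]_x
    ((c * \prod_(i < d) J i)%:E * (h d x)%:E)%E)%E.
  apply: eq_integral => x _.
  rewrite -EFinM mulrAC -(IH (c * h d x)); last 2 first.
  - by rewrite mulr_ge0.
  - by move=> i id; apply: hJ; rewrite ltnS ltnW.
  congr iint; apply/funext => v; rewrite big_ord_recr /= /upd eqxx.
  rewrite -mulrA [X in c * X]mulrC; congr (c * (_ * _))%:E.
  by apply: eq_bigr => i _; rewrite ltn_eqF.
have J0 i : (i < d)%N -> 0 <= J i.
  move=> id; rewrite -lee_fin -hJ ?ltnS 1?ltnW//.
  by apply: integral_ge0 => x _; rewrite lee_fin.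
rewrite ge0_integralZl_EFin//.
- by rewrite hJ// -EFinM big_ord_recr mulrA.
- by move=> x _; rewrite lee_fin.
- by apply/measurable_EFinP; exact: mh.
- by rewrite mulr_ge0// prodr_ge0// => i _; apply: J0.
Qed.

End IteratedIntegral.

(** * One-dimensional beta integrals *)

Section BetaIntegral.
Context {R : realType}.
Local Notation mu := (@lebesgue_measure R).

Lemma integral_itv_deriv (p : {poly R}) (t : R) : 0 <= t ->
  (\int[mu]_(x in `[0%R, t]%classic) (p^`().[x])%:E = (p.[t] - p.[0])%:E)%E.
Proof.
rewrite le_eqVlt => /orP[/eqP <-|t0].
  by rewrite set_itv1 integral_set1 subrr.
rewrite (@continuous_FTC2 _ _ (horner p)) ?EFinB//.
- by apply/continuous_subspaceT => x; apply: continuous_horner.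
- split=> [x _| |].
  + exact: derivable_horner.
  + by apply: cvg_at_right_filter; exact: continuous_horner.
  + by apply: cvg_at_left_filter; exact: continuous_horner.
- by move=> x _; rewrite -derivE.
Qed.

(* The antiderivatives satisfy [P b.+1 m = t P b m - P b m.+1]. *)
Lemma beta_primitive (t : R) (b m : nat) : exists p : {poly R},
  p^`() = 'X ^+ b * (t%:P - 'X) ^+ m
  /\ p.[t] - p.[0] = t ^+ (b + m).+1 * (b`! * m`!)%:R / (b + m).+1`!%:R.
Proof.
have nz (k : nat) : k.+1%:R != 0 :> R by rewrite pnatr_eq0.
have fz k : k`!%:R != 0 :> R by rewrite pnatr_eq0 -lt0n fact_gt0.
elim: b m => [|b IH] m.
  exists ((- m.+1%:R^-1) *: (t%:P - 'X) ^+ m.+1); split.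
    rewrite derivZ deriv_exp derivB derivC derivX sub0r -[m.+1.-1]/m.
    rewrite expr0 mul1r mulN1r mulNrn scalerN scaleNr opprK.
    by rewrite -scalerMnr scalerMnl -mulr_natr mulVf ?nz// scale1r.
  rewrite !hornerZ !horner_exp !hornerE subrr subr0 expr0n /= mulr0 sub0r.
  by rewrite factS natrM; field; rewrite fz nat1r nz.
have [p [dp pt]] := IH m; have [q [dq qt]] := IH m.+1.
exists (t *: p - q); split.
  by rewrite derivB derivZ dp dq -mul_polyC !exprS; ring.
transitivity (t * (p.[t] - p.[0]) - (q.[t] - q.[0])).
  by rewrite !hornerE; ring.
rewrite pt qt !addnS !addSn !factS !natrM !exprS.
by field; rewrite !fz -natrD nat1r -natrD nz pnatr_eq0.
Qed.

Lemma integral_beta (t : R) (b m : nat) : 0 <= t ->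
  (\int[mu]_(x in `[0%R, t]%classic) (x ^+ b * (t - x) ^+ m)%:E
   = (t ^+ (b + m).+1 * (b`! * m`!)%:R / (b + m).+1`!%:R)%:E)%E.
Proof.
move=> t0; have [p [dp <-]] := beta_primitive t b m.
rewrite -integral_itv_deriv//; apply: eq_integral => x _.
by rewrite dp !hornerE.
Qed.

(** One side of the box below a point: strict domination makes it half-open. Its endpoint is a null
    set, which leaves the beta integral with [m = 0]. *)
Lemma integral_box (y : R) (a : nat) : 0 <= y ->
  (\int[mu]_x ((0 <= (x : R) < y)%R%:R * x ^+ a)%:E = (y ^+ a.+1 / a.+1%:R)%:E)%E.
Proof.
move=> y0.
transitivity (\int[mu]_(x in `[0%R, y[%classic) (x ^+ a)%:E)%E.
  rewrite [RHS]integral_mkcond; apply: eq_integral => x _.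
  by rewrite patchE mem_setE in_itv /=; case: ifP => _; rewrite ?mul1r ?mul0r.
rewrite integral_itv_bndo_bndc; last first.
  by apply/measurable_funTS/measurable_EFinP; exact: exprn_measurable.
transitivity (\int[mu]_(x in `[0%R, y]%classic) (x ^+ a * (y - x) ^+ 0)%:E)%E.
  by apply: eq_integral => x _; rewrite expr0 mulr1.
rewrite integral_beta// addn0 fact0 muln1 factS natrM invfM; congr EFin.
have : a`!%:R != 0 :> R by rewrite pnatr_eq0 -lt0n fact_gt0.
by move=> fz; field; rewrite fz nat1r pnatr_eq0.
Qed.

(** For a simplex of size [t], [x ^+ b] is the moment factor of one coordinate and [(t - x) ^+ m]
    the scaling of the slice at height [x]. *)
Lemma integral_simplex_slice (t : R) (b m : nat) : 0 <= t ->
  (\int[mu]_x ((0 <= (x : R) <= t)%R%:R * (x ^+ b * (t - x) ^+ m))%:E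
   = (t ^+ (b + m).+1 * (b`! * m`!)%:R / (b + m).+1`!%:R)%:E)%E.
Proof.
move=> t0; rewrite -integral_beta// [RHS]integral_mkcond.
apply: eq_integral => x _.
by rewrite patchE mem_setE in_itv /=; case: ifP => _; rewrite ?mul1r ?mul0r.
Qed.

End BetaIntegral.

(** * Record probabilities in a down-set of the orthant *)

Lemma prodr_nat_of_bool (R : comNzRingType) (I : finType) (b : pred I) :
  \prod_(i : I) (b i)%:R = ([forall i, b i])%:R :> R.
Proof.
case: forallP => [b1|nb]; first by rewrite big1// => i _; rewrite b1.
have /existsP[i /negbTE bi] : [exists i, ~~ b i].
  by rewrite -negb_forall; apply/negP => /forallP.
by rewrite (bigD1 i)//= bi mul0r.
Qed.

Lemma measurable_natr_bool (R : realType) d (T : measurableType d)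
    (b : T -> bool) : measurable_fun setT b ->
  measurable_fun setT (fun t => (b t)%:R : R).
Proof.
move=> mb; rewrite (_ : (fun _ => _) = (fun t => if b t then 1 else 0 : R)).
  by apply: measurable_fun_ifT => //; exact: measurable_cst.
by apply/funext => t; case: (b t).
Qed.

(** * Integrals over sequences of points, and record indicators *)

Section Points.
Context {R : realType} {d : nat}.
Implicit Types (p : nat -> 'I_d -> R) (q y : 'I_d -> R) (n k a b : nat).

Definition pcons q p : nat -> 'I_d -> R := fun i => if i is i'.+1 then p i' else q.

Definition iint_pts n (G : (nat -> 'I_d -> R) -> R) : \bar R :=
  iint (n * d) (fun x => (G (@pt R d x))%:E).

(** The coordinates of the first point are the innermost variables, so this point is integrated
    first with all later ones fixed; the others then move down by one index. The record integrals
    are computed by repeating this step. *)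
Lemma iint_pts_strip n (G G' : (nat -> 'I_d -> R) -> R) :
  (forall p, iint d (fun v => (G (pcons (@pt R d v 0) p))%:E) = (G' p)%:E) ->
  iint_pts n.+1 G = iint_pts n G'.
Proof.
move=> GG'; rewrite /iint_pts mulSn iint_addn; congr iint; apply/funext => w.
rewrite -GG'; apply: eq_iint => v _; congr (G _)%:E.
apply/funext => -[|i]; apply/funext => j; rewrite /pt /vcat /=.
  by rewrite mul0n add0n ltn_ord.
by rewrite mulSn -addnA ltnNge leq_addr /= addKn.
Qed.

Definition point_measurable (G : (nat -> 'I_d -> R) -> R) : Prop :=
  forall d' (T : measurableType d') (u : nat -> 'I_d -> T -> R),
  (forall i j, measurable_fun setT (u i j)) ->
  measurable_fun setT (fun t => G (fun i j => u i j t)).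

Lemma point_coord_measurable G :
  point_measurable G -> coord_measurable (fun x => (G (@pt R d x))%:E).
Proof.
move=> mG d' T u mu; apply/measurable_EFinP.
by apply: (mG _ _ (fun i j => u (i * d + j)%N)) => i j.
Qed.

Lemma iint_ptsD n (G H : (nat -> 'I_d -> R) -> R) :
  point_measurable G -> point_measurable H ->
  (forall p, 0 <= G p) -> (forall p, 0 <= H p) ->
  iint_pts n (fun p => G p + H p) = (iint_pts n G + iint_pts n H)%E.
Proof.
move=> mG mH G0 H0; rewrite -iintD//.
- exact: point_coord_measurable.
- exact: point_coord_measurable.
- by move=> v; rewrite lee_fin.
- by move=> v; rewrite lee_fin.
Qed.

Lemma point_measurable_sum N (G : nat -> (nat -> 'I_d -> R) -> R) :
  (forall k, point_measurable (G k)) ->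
  point_measurable (fun p => \sum_(k < N) G k p).
Proof.
by move=> mG d' T u mu; apply: measurable_sum => k; apply: mG.
Qed.

Lemma point_measurableM (G H : (nat -> 'I_d -> R) -> R) :
  point_measurable G -> point_measurable H ->
  point_measurable (fun p => G p * H p).
Proof.
by move=> mG mH d' T u mu; apply: measurable_funM; [apply: mG|apply: mH].
Qed.

Lemma iint_pts_sum n N (G : nat -> (nat -> 'I_d -> R) -> R) (r : nat -> R) :
  (forall k, point_measurable (G k)) -> (forall k p, 0 <= G k p) ->
  (forall k, (k < N)%N -> iint_pts n (G k) = (r k)%:E) ->
  iint_pts n (fun p => \sum_(k < N) G k p) = (\sum_(k < N) r k)%:E.
Proof.
move=> mG G0; elim: N => [|N IH] Gr.
  rewrite big_ord0; apply: iint_eq0 => x.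
  by rewrite big_ord0.
rewrite big_ord_recr EFinD -IH; last by move=> k kN; apply: Gr; apply: ltnW.
rewrite -(Gr N)// -iint_ptsD//.
- by congr iint; apply/funext => x; rewrite big_ord_recr.
- exact: point_measurable_sum.
- by move=> p; apply: sumr_ge0.
Qed.

Definition monom a y : R := \prod_(j < d) y j ^+ a.

(** A product of 0-1 factors, so that removing the first point splits off exactly one factor. *)
Definition isrec k p : R := \prod_(i < k) (dominated (p i) (p k))%:R.

Lemma isrec_ge0 k p : 0 <= isrec k p.
Proof. exact: prodr_ge0. Qed.

Lemma isrec_cons k q p :
  isrec k.+1 (pcons q p) = (dominated q (p k))%:R * isrec k p.
Proof. by rewrite /isrec big_ord_recl. Qed.

Lemma isrec_idem k p : isrec k p * isrec k p = isrec k p.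
Proof.
rewrite /isrec -big_split; apply: eq_bigr => i _.
by rewrite /= -natrM mulnb andbb.
Qed.

Lemma Zn_isrec n p : @Zn R d n p = \sum_(k < n) isrec k p.
Proof.
rewrite /Zn /nrecords -sum1_card natr_sum big_mkcond; apply: eq_bigr => k _.
rewrite /isrec prodr_nat_of_bool.
rewrite (_ : (k \in _) = [forall i : 'I_n, (i < k)%N ==> dominated (p i) (p k)]);
  last by apply/idP/idP => [/set_mem|] //; exact: mem_set.
rewrite -[LHS]/(if _ then 1%R else 0%R) -mulrb; congr (_%:R); congr nat_of_bool.
(* [nrecords] quantifies over ['I_n] under the condition [i < k], whereas the product in [isrec]
   runs over ['I_k]. *)
apply/esym; apply/forallP/forallP => [h i|h i].
  by apply/implyP => ik; exact: (h (Ordinal ik)).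
exact: (implyP (h (widen_ord (ltnW (ltn_ord k)) i)) (ltn_ord i)).
Qed.

Lemma dominated_measurable d' (T : measurableType d') (u w : 'I_d -> T -> R) :
  (forall j, measurable_fun setT (u j)) -> (forall j, measurable_fun setT (w j)) ->
  measurable_fun setT
    (fun t => (dominated (fun j => u j t) (fun j => w j t))%:R : R).
Proof.
move=> mu mw.
rewrite (_ : (fun _ => _) = (fun t => \prod_(j < d) (u j t < w j t)%R%:R)).
  apply: measurable_prod => j _.
  by apply: measurable_natr_bool; apply: measurable_fun_ltr.
by apply/funext => t; rewrite prodr_nat_of_bool.
Qed.

Lemma isrec_measurable k : point_measurable (isrec k).
Proof.
move=> d' T u mu; apply: measurable_prod => i _.
by apply: (@dominated_measurable _ _ (u i) (u k)).
Qed.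

End Points.

(** * Integrals of one and of two record indicators *)

Section RecordMoments.
Context {R : realType} {d : nat}.
Implicit Types (p : nat -> 'I_d -> R) (q y : 'I_d -> R) (n k a b : nat).

Lemma iint_box (y : 'I_d -> R) a (c : R) : 0 <= c -> (forall j, 0 <= y j) ->
  iint d (fun v => (c * \prod_(j < d)
    ((0 <= @pt R d v 0 j < y j)%R%:R * @pt R d v 0 j ^+ a))%:E)
  = (c * (monom a.+1 y / (a.+1%:R ^+ d)))%:E.
Proof.
(* [Y] extends [y] by 0 to all natural indices, the form that [iint_prod] expects. *)
move=> c0 y0; pose Y i := oapp y 0 (insub i : option 'I_d).
have YE (j : 'I_d) : Y j = y j by rewrite /Y valK.
transitivity (c * \prod_(i < d) (Y i ^+ a.+1 / a.+1%:R))%:E; last first.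
  rewrite big_split /= prodr_const card_ord exprVn; congr (_ * (_ * _))%:E.
  by apply: eq_bigr => j _; rewrite YE.
rewrite -(iint_prod d (fun i x => (0 <= x < Y i)%R%:R * x ^+ a)
  (fun i => Y i ^+ a.+1 / a.+1%:R))//.
- congr iint; apply/funext => v; congr (c * _)%:E; apply: eq_bigr => j _.
  by rewrite YE.
- move=> i x; case: (boolP (0 <= x < Y i)) => [/andP[x0 _]|_].
    by rewrite mul1r exprn_ge0.
  by rewrite mul0r.
- move=> i; apply: measurable_funM; last exact: exprn_measurable.
  apply: measurable_natr_bool; apply: measurable_and.
    by apply: measurable_fun_ler.
  by apply: measurable_fun_ltr.
- by move=> i id; rewrite -(integral_box (Y i))// -[i]/(val (Ordinal id)) YE.
Qed.

(** The simplex and the cube are treated together through these properties. The factor [c] in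
    [K_moment] stands for the part of an integrand that depends on the points still to be
    integrated. *)
Variables (K : set ('I_d -> R)) (M : nat -> R).
Hypothesis K_ge0 : forall y, K y -> forall j, 0 <= y j.
Hypothesis K_down : forall y q : 'I_d -> R, K y ->
  (forall j, 0 <= q j <= y j) -> K q.
Hypothesis K_measurable : forall d' (T : measurableType d') (u : 'I_d -> T -> R),
  (forall j, measurable_fun setT (u j)) ->
  measurable_fun setT (fun t => \1_K (fun j => u j t) : R).
Hypothesis K_moment : forall a (c : R), 0 <= c ->
  iint d (fun v => (c * (monom a (@pt R d v 0) * \1_K (@pt R d v 0)))%:E)
  = (c * M a)%:E.

Lemma monom0 y : monom 0 y = 1 :> R.
Proof. by rewrite /monom big1// => j _; rewrite expr0. Qed.

Lemma monom_ge0 a y : K y -> 0 <= monom a y.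
Proof. by move=> Ky; apply: prodr_ge0 => j _; rewrite exprn_ge0// K_ge0. Qed.

Lemma moment_ge0 a : 0 <= M a.
Proof.
rewrite -lee_fin -[M a]mul1r -K_moment//; apply: iint_ge0 => v.
rewrite lee_fin mul1r indicE.
case: (boolP (_ \in _)) => [/set_mem Kv|_]; last by rewrite mulr0.
by rewrite mulr1 monom_ge0.
Qed.

(* Since K is a down-set of the orthant, the points of K below y form a box. *)
Lemma iint_dominated y a (c : R) : K y -> 0 <= c ->
  iint d (fun v => (c * (monom a (@pt R d v 0) *
    (dominated (@pt R d v 0) y)%:R * \1_K (@pt R d v 0)))%:E)
  = (c * (monom a.+1 y / (a.+1%:R ^+ d)))%:E.
Proof.
move=> Ky c0; rewrite -iint_box//; last exact: K_ge0.
congr iint; apply/funext => v; congr (c * _)%:E.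
rewrite big_split /= -/(monom a _) -mulrA mulrC; congr (_ * _).
rewrite prodr_nat_of_bool indicE -natrM mulnb; congr (_%:R); congr nat_of_bool.
apply/andP/forallP => [[/forallP vy /set_mem Kv] j|h].
  by rewrite vy K_ge0.
split; first by apply/forallP => j; have /andP[] := h j.
apply/mem_set/(K_down y) => // j; have /andP[-> /ltW ->//] := h j.
Qed.

Definition allin n p : R := \prod_(i < n) \1_K (p i).

Lemma indic_ge0 y : 0 <= \1_K y :> R.
Proof. by rewrite indicE ler0n. Qed.

Lemma allin_ge0 n p : 0 <= allin n p.
Proof. by apply: prodr_ge0 => i _; exact: indic_ge0. Qed.

Lemma allin_cons n q p : allin n.+1 (pcons q p) = \1_K q * allin n p.
Proof. by rewrite /allin big_ord_recl. Qed.

Lemma allin_measurable n : point_measurable (allin n).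
Proof.
by move=> d' T u mu; apply: measurable_prod => i _; apply: (@K_measurable _ _ (u i)).
Qed.

(** Either both sides of a stripping step vanish, or every remaining point lies in [K], as
    [iint_dominated] asks of the dominating point. *)
Lemma allin_cases n p : allin n p = 0 \/ forall k, (k < n)%N -> K (p k).
Proof.
case: (boolP [forall i : 'I_n, p i \in K]) => [/forallP h|].
  by right => k kn; apply: set_mem; exact: (h (Ordinal kn)).
rewrite negb_forall => /existsP[i /negbTE iK]; left.
by rewrite /allin (bigD1 i)//= indicE iK mul0r.
Qed.

Lemma iint_pts_allin n (c : R) : 0 <= c ->
  iint_pts n (fun p => c * allin n p) = (c * M 0 ^+ n)%:E.
Proof.
elim: n c => [|n IH] c c0.
  by rewrite /iint_pts /= /allin big_ord0.
rewrite (iint_pts_strip _ _ (fun p => c * M 0 * allin n p)) => [|p].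
  by rewrite IH ?mulr_ge0 ?moment_ge0// exprS mulrA.
rewrite mulrAC -K_moment ?mulr_ge0 ?allin_ge0//.
congr iint; apply/funext => v; rewrite allin_cons monom0.
by rewrite mul1r mulrAC mulrA.
Qed.

(** Induction on [k] with [b] general: integrating [p 0] over the box below the record multiplies
    the integrand by [monom 1] of the record, which raises [b] by one. After [k] such steps the
    record comes first and contributes [M (b + k)]; each of the [n - k.+1] later points contributes
    [M 0]. *)
Lemma iint_pts_isrec n b k (c : R) : (k < n)%N -> 0 <= c ->
  iint_pts n (fun p => c * (monom b (p k) * isrec k p * allin n p))
  = (c * (M (b + k) * M 0 ^+ (n - k.+1)))%:E.
Proof.
elim: k n b c => [|k IH] [//|n] b c kn c0.
  rewrite (iint_pts_strip _ _ (fun p => c * M b * allin n p)) => [|p].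
    by rewrite iint_pts_allin ?mulr_ge0 ?moment_ge0// addn0 subn1 /= mulrA.
  rewrite mulrAC -K_moment ?mulr_ge0 ?allin_ge0//.
  congr iint; apply/funext => v; rewrite allin_cons /isrec big_ord0; congr _%:E.
  by rewrite /=; ring.
rewrite (iint_pts_strip _ _ (fun p => c * (monom b.+1 (p k) * isrec k p * allin n p))).
  by rewrite IH// addSnnS subSS.
move=> p; have [p0|pK] := allin_cases n p.
  rewrite p0 !mulr0; apply: iint_eq0 => v.
  by rewrite allin_cons p0 !mulr0.
have Kk := pK _ kn.
(* All factors free of the stripped point serve as the constant, and the box integral is taken with
   exponent 0. *)
transitivity (c * (monom b (p k) * isrec k p * allin n p) *
    (monom 1 (p k) / (1%:R ^+ d)))%:E.
  rewrite -iint_dominated// ?mulr_ge0 ?monom_ge0 ?isrec_ge0 ?allin_ge0//.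
  congr iint; apply/funext => v; rewrite allin_cons isrec_cons /=; congr _%:E.
  by rewrite monom0; ring.
have -> : monom b.+1 (p k) = monom 1 (p k) * monom b (p k).
  by rewrite /monom -big_split; apply: eq_bigr => j _; rewrite exprS.
by rewrite expr1n divr1; congr _%:E; ring.
Qed.

(** A point below [p j] is also below [p k], so each point before [p j] only raises the exponent of
    [p j], which ends at [a + j]. When [p j] comes first it is integrated over the box below [p k];
    this yields the denominator and leaves a one-record integral for [p k]. *)
Lemma iint_pts_isrec2 n a j k (c : R) : (j < k)%N -> (k < n)%N -> 0 <= c ->
  iint_pts n (fun p => c * (monom a (p j) * isrec j p * isrec k p * allin n p))
  = (c * (M (a + k) / ((a + j).+1%:R ^+ d) * M 0 ^+ (n - k.+1)))%:E.
Proof.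
elim: j k n a c => [|j IH] [//|k] [//|n] a c jk kn c0.
  rewrite (iint_pts_strip _ _ (fun p => (c / (a.+1%:R ^+ d)) *
      (monom a.+1 (p k) * isrec k p * allin n p))).
    rewrite iint_pts_isrec// ?divr_ge0 ?exprn_ge0// addSnnS addn0 subSS.
    by congr _%:E; ring.
  move=> p; have [p0|pK] := allin_cases n p.
    rewrite p0 !mulr0; apply: iint_eq0 => v.
    by rewrite allin_cons p0 !mulr0.
  transitivity (c * (isrec k p * allin n p) *
      (monom a.+1 (p k) / (a.+1%:R ^+ d)))%:E; last by congr _%:E; ring.
  rewrite -iint_dominated ?mulr_ge0 ?isrec_ge0 ?allin_ge0//; last exact: pK.
  congr iint; apply/funext => v; rewrite allin_cons isrec_cons /=; congr _%:E.
  by rewrite /isrec big_ord0 -/(isrec k p); ring.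
rewrite (iint_pts_strip _ _
    (fun p => c * (monom a.+1 (p j) * isrec j p * isrec k p * allin n p))).
  by rewrite IH// !addSnnS subSS.
move=> p; have [p0|pK] := allin_cases n p.
  rewrite p0 !mulr0; apply: iint_eq0 => v.
  by rewrite allin_cons p0 !mulr0.
have Kj := pK _ (ltn_trans jk kn).
(* If [p k] does not dominate [p j], then [isrec k p] is 0 and both sides vanish. Otherwise
   transitivity makes the stripped point's domination by [p k] follow from its domination by
   [p j]. *)
case: (boolP (dominated (p j) (p k))) => [/forallP pjk|/negbTE pjk]; last first.
  have r0 : isrec k p = 0.
    by rewrite /isrec (bigD1 (Ordinal (jk : (j < k)%N)))//= pjk mul0r.
  rewrite r0 mulr0 mul0r mulr0; apply: iint_eq0 => v.
  by rewrite !isrec_cons r0 !mulr0 mul0r !mulr0.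
transitivity (c * (monom a (p j) * isrec j p * isrec k p * allin n p) *
    (monom 1 (p j) / (1%:R ^+ d)))%:E.
  rewrite -iint_dominated// ?mulr_ge0 ?monom_ge0 ?isrec_ge0 ?allin_ge0//.
  congr iint; apply/funext => v; rewrite allin_cons !isrec_cons /=; congr _%:E.
  rewrite monom0; case: (boolP (dominated _ (p j))) => [/forallP vj|_].
    have -> : dominated (pt v 0) (p k).
      by apply/forallP => i; exact: lt_trans (vj i) (pjk i).
    by rewrite !mulr1n; ring.
  by rewrite !mulr0n; ring.
have -> : monom a.+1 (p j) = monom 1 (p j) * monom a (p j).
  by rewrite /monom -big_split; apply: eq_bigr => i _; rewrite exprS.
by rewrite expr1n divr1; congr _%:E; ring.
Qed.

End RecordMoments.

(** * Mean and variance of the number of records *)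

Lemma sqr_sum_ord (R : comNzRingType) (X : nat -> R) n :
  (\sum_(k < n) X k) ^+ 2 =
  \sum_(k < n) (X k ^+ 2 + \sum_(j < k) 2 * (X j * X k)).
Proof.
elim: n => [|n IH]; first by rewrite !big_ord0 expr0n.
rewrite !big_ord_recr /= -IH sqrrD -mulr_sumr -mulr_suml -mulr_natl.
by rewrite addrA addrAC.
Qed.

Section RecordMeanVariance.
Context {R : realType} {d : nat}.
Variables (K : set ('I_d -> R)) (M : nat -> R).
Hypothesis K_ge0 : forall y, K y -> forall j, 0 <= y j.
Hypothesis K_down : forall y q : 'I_d -> R, K y ->
  (forall j, 0 <= q j <= y j) -> K q.
Hypothesis K_measurable : forall d' (T : measurableType d') (u : 'I_d -> T -> R),
  (forall j, measurable_fun setT (u j)) ->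
  measurable_fun setT (fun t => \1_K (fun j => u j t) : R).
Hypothesis K_moment : forall a (c : R), 0 <= c ->
  iint d (fun v => (c * (monom a (@pt R d v 0) * \1_K (@pt R d v 0)))%:E)
  = (c * M a)%:E.
Hypothesis M0_neq0 : M 0 != 0.

Local Notation v := (M 0).
Let r k : R := M k / v ^+ k.+1.
Let W n p : R := allin K n p.

Let v_neq0 n : v ^+ n != 0. Proof. by rewrite expf_neq0. Qed.

(** Turns a one-record integral into a probability times the total mass [v ^+ n]. *)
Let rE n k : (k < n)%N -> M k * v ^+ (n - k.+1) = r k * v ^+ n.
Proof.
move=> kn; rewrite /r -[in RHS](subnK kn) exprD.
by field; rewrite v_neq0.
Qed.

Lemma vol_moment : vol K = v%:E.
Proof.
rewrite -[v]mul1r -K_moment//; congr iint; apply/funext => x.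
by rewrite monom0 !mul1r.
Qed.

Let EunifE n g : Eunif n K g =
  (iint_pts n (fun p => g p * W n p)%R * ((v ^+ n)^-1)%:E)%E.
Proof. by rewrite /Eunif vol_moment. Qed.

Let mW n : point_measurable (W n).
Proof. exact: allin_measurable. Qed.

Let W0 n p : 0 <= W n p. Proof. exact: allin_ge0. Qed.

Let cst_measurable (c : R) :
  point_measurable (fun _ : nat -> 'I_d -> R => c).
Proof. by move=> d' T u mu; exact: measurable_cst. Qed.

Let G1 n (c : R) k p := c * (isrec k p * W n p).
Let G2 n (c : R) j k p := c * (isrec j p * isrec k p * W n p).

Let mG1 n c k : point_measurable (G1 n c k).
Proof.
apply: point_measurableM => //; apply: point_measurableM => //.
exact: isrec_measurable.
Qed.

Let mG2 n c j k : point_measurable (G2 n c j k).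
Proof.
apply: point_measurableM => //; apply: point_measurableM => //.
by apply: point_measurableM; exact: isrec_measurable.
Qed.

Let G1_ge0 n c k p : 0 <= c -> 0 <= G1 n c k p.
Proof. by move=> c0; rewrite !mulr_ge0 ?isrec_ge0. Qed.

Let G2_ge0 n c j k p : 0 <= c -> 0 <= G2 n c j k p.
Proof. by move=> c0; rewrite !mulr_ge0 ?isrec_ge0. Qed.

Let IpG1 n c k : 0 <= c -> (k < n)%N -> iint_pts n (G1 n c k) = (c * r k * v ^+ n)%:E.
Proof.
move=> c0 kn; rewrite -mulrA -rE// -[k in M k]add0n -(iint_pts_isrec K)//.
by congr iint; apply/funext => x; rewrite monom0 mul1r.
Qed.

Let IpG2 n c j k : 0 <= c -> (j < k)%N -> (k < n)%N ->
  iint_pts n (G2 n c j k) = (c * (j.+1%:R ^- d) * r k * v ^+ n)%:E.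
Proof.
move=> c0 jk kn.
rewrite -[RHS]/((_ * _ * _)%:E) -mulrA -rE//.
transitivity (c * (M (0 + k) / ((0 + j).+1%:R ^+ d) * v ^+ (n - k.+1)))%:E;
  last by rewrite !add0n; congr _%:E; ring.
rewrite -(iint_pts_isrec2 K)//.
by congr iint; apply/funext => x; rewrite monom0 mul1r.
Qed.

Let Ip_Zn n c : 0 <= c ->
  iint_pts n (fun p => c * (@Zn R d n p * W n p)) = (c * (\sum_(k < n) r k) * v ^+ n)%:E.
Proof.
move=> c0; rewrite mulr_sumr mulr_suml.
rewrite -(iint_pts_sum n n (G1 n c) (fun k => c * r k * v ^+ n))//.
- congr iint; apply/funext => x; rewrite Zn_isrec mulr_suml mulr_sumr.
  by [].
- by move=> k p; exact: G1_ge0.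
- by move=> k kn; exact: IpG1.
Qed.

Lemma Eunif_Zn n : Eunif n K (@Zn R d n) = (\sum_(k < n) r k)%:E.
Proof.
rewrite EunifE; transitivity ((1 * (\sum_(k < n) r k) * v ^+ n)%:E
   * ((v ^+ n)^-1)%:E)%E.
  rewrite -Ip_Zn//; congr (_ * _)%E; congr iint; apply/funext => x.
  by rewrite mul1r.
by rewrite -EFinM mul1r mulfK.
Qed.

(** The square of an indicator is the indicator, hence the first sum. The products are grouped by
    their larger index [k]; summing [j.+1 ^- d] over [j < k] then gives [harm R k d]. *)
Let Ip_Zn2 n : iint_pts n (fun p => @Zn R d n p ^+ 2 * W n p) =
  ((\sum_(k < n) r k + 2 * \sum_(k < n) r k * harm R k d) * v ^+ n)%:E.
Proof.
pose G k p := G1 n 1 k p + \sum_(j < k) G2 n 2 j k p.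
transitivity (\sum_(k < n) ((r k + 2 * (r k * harm R k d)) * v ^+ n))%:E;
  last by rewrite -mulr_suml big_split /= mulr_sumr.
rewrite -(iint_pts_sum n n G (fun k => (r k + 2 * (r k * harm R k d)) * v ^+ n))//.
- congr iint; apply/funext => x; rewrite Zn_isrec.
  rewrite (sqr_sum_ord R (fun k => isrec k (@pt R d x))) mulr_suml.
  congr _%:E; apply: eq_bigr => k _; rewrite mulrDl expr2 isrec_idem /G /G1 mul1r.
  congr (_ + _); rewrite mulr_suml; apply: eq_bigr => j _.
  by rewrite /G2 !mulrA.
- move=> k d' T u mu; apply: measurable_funD; first exact: mG1.
  by apply: (point_measurable_sum k (fun j => G2 n 2 j k)).
- move=> k p; rewrite addr_ge0 ?G1_ge0 ?sumr_ge0// => j _.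
  by rewrite G2_ge0.
- move=> k kn; rewrite /G iint_ptsD//; last 3 first.
  + exact: (point_measurable_sum k (fun j => G2 n 2 j k)).
  + by move=> p; rewrite G1_ge0.
  + by move=> p; rewrite sumr_ge0// => j _; rewrite G2_ge0.
  rewrite IpG1// (iint_pts_sum n k (fun j => G2 n 2 j k)
    (fun j => 2 * (j.+1%:R ^- d) * r k * v ^+ n))//.
  + rewrite -EFinD mul1r mulrDl; congr (_ + _)%:E.
    rewrite /harm big_add1 big_mkord !mulr_sumr mulr_suml.
    by apply: eq_bigr => j _; ring.
  + by move=> j p; rewrite G2_ge0.
  + by move=> j jk; exact: IpG2.
Qed.

Lemma Vunif_Zn n : Vunif n K (@Zn R d n) =
  (\sum_(k < n) r k + 2 * (\sum_(k < n) r k * harm R k d)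
   - (\sum_(k < n) r k) ^+ 2)%:E.
Proof.
rewrite /Vunif Eunif_Zn /= EunifE; set e := \sum_(k < n) r k.
set s := 2 * _.
(* Nonnegativity of [e] makes [2 * e * Z] a nonnegative integrand. *)
have r0 k : 0 <= r k.
  by rewrite /r divr_ge0 ?exprn_ge0// (moment_ge0 K).
have e0 : 0 <= e by rewrite sumr_ge0.
have mZ : point_measurable (@Zn R d n).
  move=> d' T u mu; under eq_fun do rewrite Zn_isrec.
  by apply: (point_measurable_sum n isrec) => // k; exact: isrec_measurable.
pose X p := (@Zn R d n p - e) ^+ 2 * W n p.
have mX : point_measurable X.
  move=> d' T u mu; apply: measurable_funM; last exact: mW.
  by apply: measurable_funX; apply: measurable_funB => //; exact: mZ.
have X0 p : 0 <= X p by rewrite mulr_ge0 ?sqr_ge0.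
have Z0 p : 0 <= @Zn R d n p by rewrite /Zn ler0n.
(* On the left, [2 * e * e * v ^+ n] is the integral of [2 * e * Z] against [W], since [Z] has mean
   [e]. *)
have sumE : (iint_pts n X + (2 * e * e * v ^+ n)%:E =
    ((e + s) * v ^+ n)%:E + (e ^+ 2 * v ^+ n)%:E)%E.
  have Z1 := Ip_Zn n (2 * e) (mulr_ge0 (ler0n _ 2) e0).
  have Z2 : _ = ((e + s) * v ^+ n)%:E := Ip_Zn2 n.
  have mM F : point_measurable F -> point_measurable (fun p => F p * W n p).
    by move=> mF; apply: point_measurableM.
  have mXl : point_measurable (fun p => 2 * e * (@Zn R d n p * W n p)).
    by apply: point_measurableM => //; apply: mM.
  have mXr : point_measurable (fun p => @Zn R d n p ^+ 2 * W n p).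
    by apply: mM; apply: point_measurableM.
  rewrite -Z2 -Z1 -(iint_pts_allin K) ?sqr_ge0//.
  rewrite -(iint_ptsD n X) -?(iint_ptsD n (fun p => @Zn R d n p ^+ 2 * W n p))//.
  - by congr iint; apply/funext => x; congr _%:E; rewrite /X /W; ring.
  - by apply: point_measurableM => //; exact: mW.
  - by move=> p; rewrite mulr_ge0 ?sqr_ge0.
  - by move=> p; rewrite mulr_ge0 ?sqr_ge0.
  - by move=> p; rewrite !mulr_ge0.
(* The added term is finite, so it may be cancelled in the extended reals. *)
have -> : iint_pts n X = ((e + s - e ^+ 2) * v ^+ n)%:E.
  rewrite -[LHS](@addeK _ (2 * e * e * v ^+ n)%:E)// sumE -!EFinD.
  by congr _%:E; ring.
by rewrite -EFinM mulfK.
Qed.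

End RecordMeanVariance.

(** * The cube and the simplex *)

Section CubeSimplex.
Context {R : realType} {d : nat}.
Implicit Types (y q : 'I_d -> R) (a : nat).

Lemma indic_cubeE y :
  \1_(@cube R d) y = \prod_(j < d) (0 <= y j <= 1)%R%:R :> R.
Proof.
rewrite prodr_nat_of_bool indicE; congr (_%:R); congr nat_of_bool.
by apply/idP/forallP => [/set_mem|h] //; apply/mem_set.
Qed.

Lemma indic_simplexE y : \1_(@simplex R d) y =
  (\prod_(j < d) (0 <= y j)%R%:R) * (\sum_(j < d) y j <= 1)%R%:R :> R.
Proof.
rewrite prodr_nat_of_bool indicE -natrM mulnb; congr (_%:R); congr nat_of_bool.
apply/idP/andP => [/set_mem[h1 h2]|[/forallP h1 h2]].
  by split => //; apply/forallP.
by apply/mem_set; split.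
Qed.

Lemma cube_ge0 y : @cube R d y -> forall j, 0 <= y j.
Proof. by move=> h j; have /andP[] := h j. Qed.

Lemma cube_down y q : @cube R d y -> (forall j, 0 <= q j <= y j) -> @cube R d q.
Proof.
move=> yc qy j; have /andP[-> /le_trans->//] := qy j.
by have /andP[] := yc j.
Qed.

Lemma simplex_ge0 y : @simplex R d y -> forall j, 0 <= y j.
Proof. by case. Qed.

Lemma simplex_down y q :
  @simplex R d y -> (forall j, 0 <= q j <= y j) -> @simplex R d q.
Proof.
move=> [_ y1] qy; split=> [j|]; first by have /andP[] := qy j.
by apply: le_trans y1; apply: ler_sum => j _; have /andP[] := qy j.
Qed.

Lemma indic_cube_measurable d' (T : measurableType d') (u : 'I_d -> T -> R) :
  (forall j, measurable_fun setT (u j)) ->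
  measurable_fun setT (fun t => \1_(@cube R d) (fun j => u j t) : R).
Proof.
move=> mu; under eq_fun do rewrite indic_cubeE.
apply: measurable_prod => j _; apply: measurable_natr_bool.
by apply: measurable_and; apply: measurable_fun_ler.
Qed.

Lemma indic_simplex_measurable d' (T : measurableType d')
    (u : 'I_d -> T -> R) : (forall j, measurable_fun setT (u j)) ->
  measurable_fun setT (fun t => \1_(@simplex R d) (fun j => u j t) : R).
Proof.
move=> mu; under eq_fun do rewrite indic_simplexE.
apply: measurable_funM.
  apply: measurable_prod => j _; apply: measurable_natr_bool.
  exact: measurable_fun_ler.
apply: measurable_natr_bool; apply: measurable_fun_ler => //.
exact: measurable_sum.
Qed.

(** The integral factors over coordinates; each factor is the slice integral with [t = 1] and
    [m = 0]. *)
Lemma cube_moment a (c : R) : 0 <= c ->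
  iint d (fun v => (c * (monom a (@pt R d v 0) * \1_(@cube R d) (@pt R d v 0)))%:E)
  = (c * a.+1%:R ^- d)%:E.
Proof.
move=> c0; rewrite -exprVn -[d in _ ^+ d]card_ord -prodr_const.
rewrite -(iint_prod d (fun _ x => (0 <= x <= 1)%R%:R * (x ^+ a * (1 - x) ^+ 0))
  (fun=> a.+1%:R^-1))//.
- congr iint; apply/funext => v; rewrite indic_cubeE -big_split /=.
  by congr (c * _)%:E; apply: eq_bigr => j _; rewrite mulr1 mulrC.
- move=> _ x; case: (boolP (0 <= x <= 1)) => [/andP[x0 _]|_].
    by rewrite mulr1 mul1r exprn_ge0.
  by rewrite mul0r.
- move=> _; under eq_fun do rewrite expr0 mulr1.
  apply: measurable_funM; last exact: exprn_measurable.
  by apply: measurable_natr_bool; apply: measurable_and; apply: measurable_fun_ler.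
- move=> _ _; rewrite integral_simplex_slice// addn0 fact0 muln1 expr1n mul1r.
  rewrite factS natrM invfM mulrC -mulrA mulVf ?mulr1//.
Qed.

(** Dirichlet's integral over a simplex of size [t]. The size is general because fixing the last
    coordinate at [x] leaves a simplex of size [t - x]; the factor for [0 <= t] covers the case
    where this is empty. *)
Lemma iint_simplex m a (c t : R) : 0 <= c ->
  iint m (fun v => (c * (\prod_(i < m) ((0 <= v i)%R%:R * v i ^+ a) *
    (\sum_(i < m) v i <= t)%R%:R))%:E)
  = (c * ((0 <= t)%R%:R * t ^+ (m * a.+1) * (a`! ^ m)%:R
      / (m * a.+1)`!%:R))%:E.
Proof.
elim: m c t => [|m IH] c t c0 /=.
  by rewrite !big_ord0 mul0n expr0 expn0 fact0 mul1r divr1 !mulr1.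
pose C : R := (a`! ^ m)%:R / (m * a.+1)`!%:R.
have C0 : 0 <= C by rewrite divr_ge0.
transitivity (\int[@lebesgue_measure R]_x ((c * C)%:E *
  ((0 <= (x : R) <= t)%R%:R * (x ^+ a * (t - x) ^+ (m * a.+1)))%:E))%E.
  apply: eq_integral => /= x _.
  transitivity (((c * ((0 <= (x : R))%R%:R * x ^+ a)) *
    ((0 <= t - x)%R%:R * (t - x) ^+ (m * a.+1) * (a`! ^ m)%:R
      / (m * a.+1)`!%:R))%:E); last first.
    rewrite -EFinM subr_ge0 /C -mulnb natrM; congr _%:E; ring.
  rewrite -IH.
    congr iint; apply/funext => v; rewrite !big_ord_recr /= /upd eqxx.
    rewrite -lerBrDr; congr _%:E.
    under eq_bigr do rewrite ltn_eqF//.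
    have -> : \sum_(i < m) (if (i : nat) == m then (x : R) else v i) = \sum_(i < m) v i.
      by apply: eq_bigr => i _; rewrite ltn_eqF.
    by ring.
  case: (boolP (0 <= (x : R))) => [x0|_]; last by rewrite mul0r mulr0.
  by rewrite mul1r mulr_ge0// exprn_ge0.
have [t0|t0] := leP 0 t; last first.
  rewrite !mul0r mulr0; apply: integral0_eq => x _.
  have -> : (0 <= (x : R) <= t) = false.
    by apply/negP => /andP[x0 /(le_trans x0)]; rewrite leNgt t0.
  by rewrite mul0r mule0.
rewrite ge0_integralZl_EFin ?mulr_ge0//.
- rewrite integral_simplex_slice// -EFinM mulSn addSn expnS; congr _%:E.
  rewrite /C !natrM mul1r.
  (* The factor [q] to cancel is the factorial of [m * a.+1]: the denominator of [C], and a
     numerator of the beta integral. *)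
  have cancel (p q u w f : R) : q != 0 ->
    c * (p / q) * (u * (w * q) * f) = c * (u * (w * p) * f).
    by move=> q0; field.
  by rewrite cancel// pnatr_eq0 -lt0n fact_gt0.
- move=> x _; rewrite lee_fin.
  case: (boolP (0 <= (x : R) <= t)) => [/andP[x0 xt]|_]; last by rewrite mul0r.
  by rewrite mul1r mulr_ge0// exprn_ge0// subr_ge0.
- apply/measurable_EFinP; apply: measurable_funM.
    apply: measurable_natr_bool.
    by apply: measurable_and; apply: measurable_fun_ler.
  apply: measurable_funM; first exact: exprn_measurable.
  by apply: measurable_funX; apply: measurable_funB.
Qed.

Lemma simplex_moment a (c : R) : 0 <= c ->
  iint d (fun v =>
    (c * (monom a (@pt R d v 0) * \1_(@simplex R d) (@pt R d v 0)))%:E)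
  = (c * ((a`! ^ d)%:R / (d * a.+1)`!%:R))%:E.
Proof.
move=> c0; have := iint_simplex d a c 1 c0.
rewrite ler01 expr1n !mul1r => <-.
congr iint; apply/funext => v; rewrite indic_simplexE [monom _ _ * _]mulrA -big_split /=.
by congr (c * (_ * _))%:E; apply: eq_bigr => j _; rewrite mulrC.
Qed.

End CubeSimplex.

(** * Reindexing to the closed formulas *)

Lemma harm_ord (R : realType) m a :
  harm R m a = \sum_(k < m) k.+1%:R ^- a.
Proof. by rewrite /harm big_add1 big_mkord. Qed.

Theorem theorem5 (R : realType) (d n : nat) (hd : (1 <= d)%N) :
  [/\ Eunif n (@simplex R d) (@Zn R d n)
        = (\sum_(1 <= k < n.+1) coefS R d k)%:E,
      Vunif n (@simplex R d) (@Zn R d n)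
        = (2 * (\sum_(2 <= k < n.+1) coefS R d k * harm R k.-1 d)
           + \sum_(1 <= k < n.+1) coefS R d k
           - (\sum_(1 <= k < n.+1) coefS R d k) ^+ 2)%:E,
      Eunif n (@cube R d) (@Zn R d n) = (harm R n d)%:E
    & Vunif n (@cube R d) (@Zn R d n) = (harm R n d - harm R n (2 * d))%:E].
Proof.
(* The moments of the simplex and of the cube; at exponent 0 they are the volumes [1 / d!] and 1. *)
pose MS a : R := (a`! ^ d)%:R / (d * a.+1)`!%:R.
pose MC a : R := a.+1%:R ^- d.
have MS0 : MS 0%N = d`!%:R^-1 by rewrite /MS fact0 exp1n muln1 mul1r.
have MS0n : MS 0%N != 0.
  by rewrite MS0 invr_neq0// pnatr_eq0 -lt0n fact_gt0.
have MC0 : MC 0%N = 1 by rewrite /MC expr1n invr1.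
have MC0n : MC 0%N != 0 by rewrite MC0 oner_neq0.
(* Records are indexed from 0 and [coefS] from 1, so [k! ^ d] is the Gamma factor of [k.+1]. *)
have coefE k : MS k / MS 0%N ^+ k.+1 = coefS R d k.+1.
  by rewrite MS0 exprVn invrK /MS /coefS natrM !natrX mulrC mulrA.
have sumS : \sum_(1 <= k < n.+1) coefS R d k =
    \sum_(k < n) MS k / MS 0%N ^+ k.+1.
  by rewrite big_add1 big_mkord; apply: eq_bigr => k _; rewrite coefE.
(* The first point's term vanishes because [harm R 0 d] is 0, so the sum may start at 2. *)
have sumSH : \sum_(2 <= k < n.+1) coefS R d k * harm R k.-1 d =
    \sum_(k < n) MS k / MS 0%N ^+ k.+1 * harm R k d.
  rewrite big_add1 /=; case: (n) => [|m]; first by rewrite big_geq// big_ord0.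
  rewrite -(big_mkord xpredT (fun k => MS k / MS 0%N ^+ k.+1 * harm R k d)).
  rewrite [RHS]big_ltn// [harm R 0 d]harm_ord big_ord0 mulr0 add0r.
  by apply: eq_bigr => k _; rewrite coefE.
have rC k : MC k / MC 0%N ^+ k.+1 = k.+1%:R ^- d by rewrite MC0 expr1n divr1.
split.
- rewrite (Eunif_Zn _ MS simplex_ge0 simplex_down indic_simplex_measurable
    simplex_moment MS0n).
  by rewrite sumS.
- rewrite (Vunif_Zn _ MS simplex_ge0 simplex_down indic_simplex_measurable
    simplex_moment MS0n).
  by rewrite sumS sumSH [2 * _ + _]addrC.
- rewrite (Eunif_Zn _ MC cube_ge0 cube_down indic_cube_measurable
    cube_moment MC0n).
  by rewrite harm_ord; congr _%:E; apply: eq_bigr => k _; rewrite rC.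
- rewrite (Vunif_Zn _ MC cube_ge0 cube_down indic_cube_measurable
    cube_moment MC0n).
  under eq_bigr do rewrite rC.
  under [X in _ + _ * X - _]eq_bigr do rewrite rC.
  (* Expanding the squared mean gives a diagonal, equal to [harm R n (2 * d)], and cross terms that
     cancel the doubled harmonic sum. *)
  rewrite !harm_ord (sqr_sum_ord _ (fun k => k.+1%:R ^- d)) big_split /=.
  rewrite [X in _ - (_ + X)](_ : _ =
    2 * \sum_(k < n) k.+1%:R ^- d * harm R k d); last first.
    rewrite mulr_sumr; apply: eq_bigr => k _; rewrite harm_ord !mulr_sumr.
    by apply: eq_bigr => j _; congr (_ * _); rewrite mulrC.
  rewrite [X in _ - (X + _)](_ : _ = \sum_(k < n) k.+1%:R ^- (2 * d)).
    by congr _%:E; ring.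
  by apply: eq_bigr => k _; rewrite -exprVn -exprM mulnC exprVn.
Qed.
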